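(* Let $\nu>0$ and $0<m_{\min}<m_{\max}$, and let $$\rho(\delta_S,\delta_D,m)=\left|\frac{2\nu|m|-\delta_D}{2\nu|m|+\delta_S}\right|.$$ The solution of the min-max problem $$\min_{0<\delta_S<\delta_D}\ \max_{m\in[m_{\min},m_{\max}]}\rho(\delta_S,\delta_D,m)$$ is given, for any $\delta_S^*>0$, by the pair $(\delta_S^*,\delta_D^* )$ with $$\delta_D^*=\frac{4\nu^2m_{\min}m_{\max}+\nu(m_{\min}+m_{\max})\delta_S^*}{\nu(m_{\min}+m_{\max})+\delta_S^*}.$$ Moreover, $0<\delta_S^*<\delta_D^*$ and $\rho(\delta_S^*,\delta_D^*,m)<1$ for all $m\in[m_{\min},m_{\max}]$.
   Context: $\nu$ is the kinematic viscosity, $\delta_S,\delta_D>0$ are Robin parameters, $m$ is the Fourier frequency in the direction tangential to the interface, and $m_{\min}=\pi/L$, $m_{\max}=\pi/h$, where $L$ is the length of the interface and $h$ is the mesh size. The function $\rho$ is the convergence factor the paper associates with the ensemble domain decomposition iteration.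
   Formalization: False as printed (ν=1, m_min=1, m_max=4, δ_S*=10 gives δ_D*=4.4<δ_S* ). Here δ_S* is fixed and the minimum is over δ_D only; δ_S*<δ_D* and optimality under that constraint are claimed only for δ_S*<2ν√(m_min m_max), with no solution otherwise. *)

(* Defs.v *)
From mathcomp Require Import all_boot all_order all_algebra.
From mathcomp Require Import all_classical all_reals all_analysis.

Set Implicit Arguments.
Unset Strict Implicit.
Unset Printing Implicit Defensive.

Import Order.TTheory GRing.Theory Num.Theory.
Import numFieldNormedType.Exports.

Local Open Scope classical_set_scope.
Local Open Scope ring_scope.

Definition rho (R : realType) (nu dS dD m : R) : R :=
  `| (2 * nu * `|m| - dD) / (2 * nu * `|m| + dS) |.

(* For nu, mmin, dS > 0 and mmin <= mmax this supremum is attained, see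
   [max_rho_attained] below, so it is the maximum of rho over the interval. *)
Definition max_rho (R : realType) (nu mmin mmax dS dD : R) : R :=
  sup [set rho nu dS dD m | m in `[mmin, mmax]].

Definition admissible (R : realType) : set (R * R) :=
  [set d | 0 < d.1 < d.2].

(* The Robin parameter dS is prescribed and the minimum is taken over the
   admissible pairs with this first component: the minimum over both
   parameters jointly is never attained when mmin < mmax. *)
Definition min_max_solution (R : realType) (nu mmin mmax dS dD : R) : Prop :=
  admissible (dS, dD) /\
  forall dD' : R, admissible (dS, dD') ->
    max_rho nu mmin mmax dS dD <= max_rho nu mmin mmax dS dD'.

Definition deltaD_opt (R : realType) (nu mmin mmax dS : R) : R :=
  (4 * nu ^+ 2 * mmin * mmax + nu * (mmin + mmax) * dS) /
  (nu * (mmin + mmax) + dS).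

Lemma max_rho_attained (R : realType) (nu mmin mmax dS dD : R) :
  0 < nu -> 0 < mmin -> mmin <= mmax -> 0 < dS ->
  exists2 m, m \in `[mmin, mmax] & rho nu dS dD m = max_rho nu mmin mmax dS dD.
Proof.
move=> nu0 a0 ab s0.
have cont : {within `[mmin, mmax], continuous (rho nu dS dD)}.
  apply: continuous_subspaceT => x.
  have den : 2 * nu * `|x| + dS != 0.
    by rewrite gt_eqF// ltr_wpDl// !mulr_ge0// ltW.
  have cabs : (fun m : R => 2 * nu * `|m|) @ x --> 2 * nu * `|x|.
    by apply: cvgM; [exact: cvg_cst | apply: cvg_norm; exact: cvg_id].
  rewrite /rho; apply: cvg_norm; apply: cvgM.
    by apply: cvgB => //; exact: cvg_cst.
  by apply: cvgV => //; apply: cvgD => //; exact: cvg_cst.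
have [c cab cmax] := EVT_max ab cont.
exists c => //; apply/eqP; rewrite eq_le; apply/andP; split.
  apply: ub_le_sup; last by exists c.
  by exists (rho nu dS dD c) => _ [m /= mab <-]; apply: cmax.
apply: ge_sup; first by exists (rho nu dS dD c), c.
by move=> _ [m /= mab <-]; apply: cmax.
Qed.

(* Main.v *)
(** Put [a = 2 nu mmin], [b = 2 nu mmax], [s = dS] and [K = (b - a) / (a + b + 2 s)].
    The value [D = deltaD_opt] equioscillates: [D - a = K (a + s)] and
    [b - D = K (b + s)], with [0 < K < 1].  For [D' >= D] the maximum of [rho] is
    attained at [mmin] and equals [(D' - a) / (a + s)], which increases with [D'];
    for [D' < D] the value at [mmax] already exceeds [K].  Finally
    [(a + b + 2 s) (D - s) = 2 (a b - s ^ 2)], so [s < D] iff [s < sqrt (a b)];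
    otherwise every admissible [D'] lies in the increasing regime and can be lowered. *)

Require Import Defs.
From mathcomp Require Import all_boot all_order all_algebra.
From mathcomp Require Import all_classical all_reals all_analysis.
From mathcomp Require Import ring lra.

Import Order.TTheory GRing.Theory Num.Theory.
Import numFieldNormedType.Exports.

Local Open Scope ring_scope.

(** The constant [K] above with numerator and denominator halved, so that it shares the denominator
    of [deltaD_opt]. *)
Definition equi_rho {R : realType} (nu mmin mmax dS : R) : R :=
  nu * (mmax - mmin) / (nu * (mmin + mmax) + dS).

Section RobinParameters.
Variables (R : realType) (nu mmin mmax dS : R).
Hypotheses (nu_gt0 : 0 < nu) (mmin_gt0 : 0 < mmin) (mmin_lt_mmax : mmin < mmax).
Hypothesis dS_gt0 : 0 < dS.

Local Notation dD := (deltaD_opt nu mmin mmax dS).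
Local Notation K := (equi_rho nu mmin mmax dS).

Let mmax_gt0 : 0 < mmax.
Proof. exact: lt_trans mmin_lt_mmax. Qed.

Let den_gt0 {m : R} : 0 < m -> 0 < 2 * nu * m + dS.
Proof. by move=> m0; rewrite addr_gt0// !mulr_gt0. Qed.

Let den_opt_gt0 : 0 < nu * (mmin + mmax) + dS.
Proof. by rewrite addr_gt0// mulr_gt0// addr_gt0. Qed.

Let itv_gt0 {m : R} : m \in `[mmin, mmax] -> 0 < m.
Proof. by rewrite in_itv/= => /andP[+ _]; exact: lt_le_trans. Qed.

Lemma rho_posE (dD' m : R) : 0 < m ->
  rho nu dS dD' m = `|2 * nu * m - dD'| / (2 * nu * m + dS).
Proof.
by move=> m0; rewrite /rho normrM normfV (gtr0_norm m0) (gtr0_norm (den_gt0 m0)).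
Qed.

Lemma rho_le_max_rho (dD' : R) {m : R} : m \in `[mmin, mmax] ->
  rho nu dS dD' m <= max_rho nu mmin mmax dS dD'.
Proof.
move=> mab; apply: ub_le_sup; last by exists m.
(* A [sup] dominates its elements once the set is bounded: here the numerator is at most
   [2 nu mmax + |dD'|] and the denominator at least [dS]. *)
exists ((2 * nu * mmax + `|dD'|) / dS) => _ [x /= xab <-].
have x0 := itv_gt0 xab.
have xs0 := den_gt0 x0.
rewrite rho_posE//; apply: ler_pM => //; first by rewrite invr_ge0 ltW.
  2: by rewrite lef_pV2 ?posrE// lerDr !mulr_ge0// ltW.
rewrite (le_trans (ler_normB _ _))// lerD2r gtr0_norm ?mulr_gt0//.
by rewrite ler_pM2l ?mulr_gt0//; move: xab; rewrite in_itv/= => /andP[].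
Qed.

Lemma max_rho_le (dD' c : R) :
  (forall m, m \in `[mmin, mmax] -> rho nu dS dD' m <= c) ->
  max_rho nu mmin mmax dS dD' <= c.
Proof.
move=> h; apply: ge_sup; last by move=> _ [m /= mab <-]; exact: h.
by exists (rho nu dS dD' mmin), mmin => //=; rewrite in_itv/= lexx ltW.
Qed.

Lemma equi_rho_gt0 : 0 < K.
Proof. by rewrite divr_gt0// mulr_gt0// subr_gt0. Qed.

(** The denominator exceeds the numerator by [2 nu mmin + dS]. *)
Lemma equi_rho_lt1 : K < 1.
Proof.
have a0 : 0 < nu * mmin by exact: mulr_gt0.
have h : nu * (mmax - mmin) < nu * (mmin + mmax) + dS by move: dS_gt0; lra.
by rewrite ltr_pdivrMr// mul1r.
Qed.

Lemma deltaD_optE_min : dD = 2 * nu * mmin + K * (2 * nu * mmin + dS).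
Proof. by rewrite /deltaD_opt /equi_rho; field; rewrite gt_eqF. Qed.

Lemma deltaD_optE_max : dD = 2 * nu * mmax - K * (2 * nu * mmax + dS).
Proof. by rewrite /deltaD_opt /equi_rho; field; rewrite gt_eqF. Qed.

(** With [x = 2 nu m] and [c] the right-hand side, [dD' - x <= dD' - a = c (a + s) <= c (x + s)],
    while [x - dD' <= x - dD <= K (x + s) <= c (x + s)]. *)
Lemma max_rho_ge_deltaD_opt (dD' : R) : dD <= dD' ->
  max_rho nu mmin mmax dS dD' = (dD' - 2 * nu * mmin) / (2 * nu * mmin + dS).
Proof.
move=> DD'; have a0 := den_gt0 mmin_gt0.
have K0 := equi_rho_gt0; have K1 := equi_rho_lt1.
have KE := deltaD_optE_min; have KE' := deltaD_optE_max.
apply/eqP; rewrite eq_le; apply/andP; split; last first.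
  have mab : mmin \in `[mmin, mmax] by rewrite in_itv/= lexx ltW.
  apply: le_trans (rho_le_max_rho dD' mab).
  by rewrite rho_posE// ler_pM2r ?invr_gt0// distrC ler_norm.
set c := _ / _; have cE : c * (2 * nu * mmin + dS) = dD' - 2 * nu * mmin.
  by rewrite divfK// gt_eqF.
have Kc : K <= c by rewrite ler_pdivlMr//; lra.
apply: max_rho_le => m mab; have m0 := itv_gt0 mab.
rewrite rho_posE// ler_pdivrMr ?den_gt0//.
have [ax xb] : 2 * nu * mmin <= 2 * nu * m /\ 2 * nu * m <= 2 * nu * mmax.
  by move: mab; rewrite in_itv/= !ler_pM2l ?mulr_gt0// => /andP.
have xs0 := den_gt0 m0.
have h1 : K * (2 * nu * m + dS) <= c * (2 * nu * m + dS) by rewrite ler_pM2r.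
have h2 : c * (2 * nu * mmin + dS) <= c * (2 * nu * m + dS).
  by rewrite ler_pM2l ?lerD2r// (lt_le_trans K0).
(* [x - K (x + s)] is nondecreasing in [x] since [K < 1], and equals [dD] at [b]. *)
have h3 : 0 <= (1 - K) * (2 * nu * mmax - 2 * nu * m).
  by rewrite mulr_ge0 ?subr_ge0// ltW.
rewrite ler_norml; apply/andP; split; first lra.
have h4 : 2 * nu * m - dD <= K * (2 * nu * m + dS) by rewrite KE'; lra.
lra.
Qed.

Lemma max_rho_deltaD_opt : max_rho nu mmin mmax dS dD = K.
Proof.
rewrite max_rho_ge_deltaD_opt// deltaD_optE_min [_ + _ - _]addrAC subrr add0r.
by rewrite mulfK// gt_eqF// den_gt0.
Qed.

Lemma max_rho_lt_homo (dD1 dD2 : R) : dD <= dD1 -> dD1 < dD2 ->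
  max_rho nu mmin mmax dS dD1 < max_rho nu mmin mmax dS dD2.
Proof.
move=> h1 h12; rewrite !max_rho_ge_deltaD_opt//; last by rewrite (le_trans h1) ?ltW.
by rewrite ltr_pM2r ?invr_gt0 ?den_gt0// ltrD2r.
Qed.

Lemma max_rho_deltaD_opt_lt (dD' : R) : dD' != dD ->
  max_rho nu mmin mmax dS dD < max_rho nu mmin mmax dS dD'.
Proof.
rewrite neq_lt => /orP[h|]; last exact: max_rho_lt_homo.
have mab : mmax \in `[mmin, mmax] by rewrite in_itv/= lexx ltW.
apply: lt_le_trans (rho_le_max_rho dD' mab).
(* As [dD' < dD], already [b - dD'] exceeds [b - dD = K (b + s)]. *)
rewrite max_rho_deltaD_opt rho_posE// ltr_pdivlMr ?den_gt0//.
apply: lt_le_trans (ler_norm _).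
by rewrite deltaD_optE_max in h; lra.
Qed.

(** Clearing the denominator cancels the term [nu (mmin + mmax) dS] and leaves
    [dS ^ 2 < 4 nu ^ 2 mmin mmax], the square of the other inequality. *)
Lemma lt_deltaD_opt : (dS < dD) = (dS < 2 * nu * Num.sqrt (mmin * mmax)).
Proof.
have ab0 : 0 <= mmin * mmax by rewrite mulr_ge0 ?ltW.
rewrite -[RHS](@ltr_pXn2r _ 2)// ?nnegrE ?mulr_ge0 ?sqrtr_ge0 ?ltW//.
rewrite exprMn sqr_sqrtr// /deltaD_opt ltr_pdivlMr//.
by apply/idP/idP => h; lra.
Qed.

End RobinParameters.

Theorem theorem5p2 (R : realType) (nu mmin mmax : R)
  (nu_gt0 : 0 < nu) (mmin_gt0 : 0 < mmin) (mmin_lt_mmax : mmin < mmax)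
  (dS : R) (dS_gt0 : 0 < dS) :
  let dD := deltaD_opt nu mmin mmax dS in
  [/\ (* for every dS > 0, dD is the strict minimizer over all dD' > 0 *)
      forall dD' : R, 0 < dD' -> dD' != dD ->
        max_rho nu mmin mmax dS dD < max_rho nu mmin mmax dS dD',
      (* the admissibility of (dS, dD) fails for large dS *)
      0 < dS < dD <-> dS < 2 * nu * Num.sqrt (mmin * mmax),
      dS < 2 * nu * Num.sqrt (mmin * mmax) ->
        forall dD' : R, min_max_solution nu mmin mmax dS dD' <-> dD' = dD,
      2 * nu * Num.sqrt (mmin * mmax) <= dS ->
        forall dD' : R, ~ min_max_solution nu mmin mmax dS dD'
    & forall m : R, m \in `[mmin, mmax] -> rho nu dS dD m < 1].
Proof.
move=> dD; split.
- by move=> dD' _; exact: max_rho_deltaD_opt_lt.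
- by rewrite dS_gt0/= lt_deltaD_opt.
- rewrite -lt_deltaD_opt// => sD dD'; split=> [[adm min]|->].
    (* If [dD'] differs from [dD], then [dD] is an admissible competitor with a strictly smaller
       maximum. *)
    apply: contraPP min => /eqP neq /(_ dD).
    rewrite leNgt max_rho_deltaD_opt_lt//.
    by move=> /(_ _)/notF; apply; rewrite /admissible/= dS_gt0.
  split; first by rewrite /admissible/= dS_gt0.
  move=> d _; have [->//|neq] := eqVneq d dD.
  by rewrite ltW// max_rho_deltaD_opt_lt.
- rewrite leNgt -lt_deltaD_opt// -leNgt => Ds dD' [/= /andP[_ /= sD'] min].
  (* The midpoint of [dS] and [dD'] is admissible, and it stays above [dD] because [dD <= dS]; so it
     strictly improves on [dD']. *)
  have [sM MD'] := midf_lt sD'.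
  have /min : admissible (dS, (dS + dD') / 2) by rewrite /admissible/= dS_gt0.
  by rewrite leNgt max_rho_lt_homo// (le_trans Ds)// ltW.
- move=> m mab; have : equi_rho nu mmin mmax dS < 1 by exact: equi_rho_lt1.
  apply: le_lt_trans; rewrite -max_rho_deltaD_opt//; exact: rho_le_max_rho.
Qed.
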